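(* A monounary algebra $(A,f)$ is completely separable if and only if for all $a\in A$ there exists $n\in\mathbb{N}$ such that $B_n(a)=\varnothing$.
   Context: $\mathbb{N}$ is the set of non-negative integers. A monounary algebra $(A,f)$ is a (possibly empty) set $A$ with a function $f:A\to A$. A homomorphism $\phi:(A,f_1)\to(B,f_2)$ is a function with $\phi(f_1(a))=f_2(\phi(a))$ for all $a\in A$. For $a\in A$ and $n\in\mathbb{N}$, $f^{-n}(a)=\{b\in A: f^n(b)=a\}$ (with $f^0$ the identity), and $B_n(a)=f^{-n}(a)\setminus\bigcup_{i=0}^{n-1}f^{-i}(a)$. $A$ is completely separable if for every $a\in A$ there exist a finite monounary algebra $F$ and a homomorphism $\phi:A\to F$ such that $\phi(a)\notin\phi(A\setminus\{a\})$. *)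

(* Defs.v *)
From mathcomp Require Import all_boot.
From mathcomp Require Import boolp classical_sets functions cardinality.

Set Implicit Arguments.
Unset Strict Implicit.
Unset Printing Implicit Defensive.

Local Open Scope classical_set_scope.

(* The carrier is an arbitrary, possibly empty, type. *)
Record monounary := Monounary {
  carrier :> Type;
  op : carrier -> carrier
}.

Definition homomorphism (A B : monounary) (phi : A -> B) : Prop :=
  forall a : A, phi (op a) = op (phi a).

Definition finite_algebra (F : monounary) : Prop := finite_set [set: F].

Definition completely_separable (A : monounary) : Prop :=
  forall a : A, exists (F : monounary) (phi : A -> F),
    [/\ finite_algebra F, homomorphism phi & ~ (phi @` [set~ a]) (phi a)].

(* f^{-n}(a) *)
Definition preim_iter (A : monounary) (n : nat) (a : A) : set A :=
  iter n (@op A) @^-1` [set a].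

(* B_n(a); the union ranges over 0 <= i <= n - 1 and is empty for n = 0. *)
Definition B_ (A : monounary) (n : nat) (a : A) : set A :=
  preim_iter n a `\` \bigcup_(i < n) preim_iter i a.

(* Main.v *)
Require Import Defs.
From mathcomp Require Import all_boot.
From mathcomp Require Import boolp classical_sets functions cardinality.

(** The set [B_ n a] consists of the points that reach [a] for the first time
    after exactly [n] steps.

    If a homomorphism [phi] into a finite algebra separates [a] from all other
    points, then it preserves first hitting times: [phi b] first reaches
    [phi a] exactly when [b] first reaches [a].  In an algebra with [N]
    elements a first hitting time is smaller than [N], because a longer path
    repeats a point and cutting out the loop gives an earlier visit
    ([B_card_eq0]).  So [B_ N a] is empty.

    Conversely, if [B_ n a] is empty, then every point reaches [a] in fewer
    than [n] steps or never.  The first hitting time of [a], with the value [n]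
    standing for never, is then itself a homomorphism into a finite algebra
    ([hit_time_homo]): each step decreases the time by one, never remains
    never, and the time 0 has a well-defined successor since it is attained
    at [a] only.  For the same reason this homomorphism separates [a]. *)

Set Implicit Arguments.
Unset Strict Implicit.
Unset Printing Implicit Defensive.

Local Open Scope classical_set_scope.

Lemma iter_homo (A F : monounary) (phi : A -> F) (n : nat) (b : A) :
  homomorphism phi -> phi (iter n (@op A) b) = iter n (@op F) (phi b).
Proof. by move=> hphi; elim: n => //= n <-; exact: hphi. Qed.

Lemma B_P (A : monounary) (n : nat) (a b : A) :
  B_ n a b <->
  iter n (@op A) b = a /\ forall i, i < n -> iter i (@op A) b <> a.
Proof.
split=> [[hb nhb]|[hb nhb]]; split=> //.
- by move=> i lt_in hi; apply: nhb; exists i.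
- by case=> i /= lt_in hi; apply: nhb lt_in hi.
Qed.

(** Since no other point is identified with [a], the path of [phi b] cannot
    visit [phi a] before the path of [b] visits [a]. *)
Lemma B_homo (A F : monounary) (phi : A -> F) (n : nat) (a b : A) :
  homomorphism phi -> ~ (phi @` [set~ a]) (phi a) ->
  B_ n a b -> B_ n (phi a) (phi b).
Proof.
move=> hphi sep /B_P[hb nhb]; apply/B_P; split.
  by rewrite -iter_homo // hb.
move=> i lt_in; rewrite -iter_homo // => hi.
by apply: sep; exists (iter i (@op A) b) => //; exact: nhb.
Qed.

(** The first [n + 1] points on the way from a point of [B_ n a] to [a] are
    pairwise distinct, since cutting out a loop would give an earlier visit
    to [a]. *)
Lemma B_iter_inj (A : monounary) (n : nat) (a b : A) :
  B_ n a b -> {in `I_n.+1 &, injective (fun i => iter i (@op A) b)}.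
Proof.
move=> /B_P[hb nhb].
have loop i j : i < j -> j <= n -> iter i (@op A) b <> iter j (@op A) b.
  move=> lt_ij le_jn eq_ij; apply: (nhb (n - j + i)).
    by rewrite -[X in _ < X](subnK le_jn) ltn_add2l.
  by rewrite iterD eq_ij -iterD subnK.
move=> i j /set_mem /= le_in /set_mem /= le_jn eq_ij.
by case: (ltngtP i j) => // lt_ij; [case: (loop i j)|case: (loop j i)].
Qed.

Lemma B_card_eq0 (F : monounary) (N : nat) (a : F) :
  ([set: F] #= `I_N)%card -> B_ N a = set0.
Proof.
move=> cardF; rewrite -subset0 => b /B_iter_inj inj_b.
have : (`I_N.+1 #<= `I_N)%card.
  rewrite -(card_le_eqr cardF) -(card_le_eql (inj_card_eq inj_b)).
  exact: subset_card_le.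
by rewrite card_le_II ltnn.
Qed.

Section HitTime.

Variables (A : monounary) (a : A) (n : nat).

(** When [a] is not reached in fewer than [n] steps, [find] returns the length
    [n] of the list of candidates, which serves as the value at infinity. *)
Definition hit_time (c : A) : nat :=
  find (fun k => `[< iter k (@op A) c = a >]) (iota 0 n).

Lemma hit_time_le (c : A) : hit_time c <= n.
Proof. by rewrite -[X in _ <= X](size_iota 0) find_size. Qed.

Lemma iter_hit_time (c : A) :
  hit_time c < n -> iter (hit_time c) (@op A) c = a.
Proof.
move=> lt_cn; apply/asboolP.
have := @nth_find _ 0 (fun k => `[< iter k (@op A) c = a >]) (iota 0 n).
by rewrite has_find size_iota nth_iota //; apply.
Qed.

Lemma hit_time_min (c : A) (k : nat) :
  k < hit_time c -> iter k (@op A) c <> a.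
Proof.
move=> lt_kc /asboolP hk; have := before_find 0 lt_kc.
by rewrite nth_iota ?hk // (leq_trans lt_kc) ?hit_time_le.
Qed.

Lemma hit_timeE (c : A) (k : nat) :
  k <= n -> (k < n -> iter k (@op A) c = a) ->
  (forall i, i < k -> iter i (@op A) c <> a) -> hit_time c = k.
Proof.
move=> le_kn hk nhk; case: (ltngtP (hit_time c) k) => // lt.
  by case: (nhk _ lt); apply: iter_hit_time; exact: leq_trans lt le_kn.
case: (hit_time_min lt); apply: hk.
exact: leq_trans lt (hit_time_le c).
Qed.

Hypothesis Bn0 : B_ n a = set0.

(** [B_ 0 a] contains [a]. *)
Lemma B_eq0_gt0 : 0 < n.
Proof.
case: n Bn0 => // B00; have : B_ 0 a a by apply/B_P.
by rewrite B00.
Qed.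

Lemma hit_time_eq0 (c : A) : hit_time c = 0 <-> c = a.
Proof.
split=> [c0|ca]; last by apply: hit_timeE.
by have := @iter_hit_time c; rewrite c0 => /(_ B_eq0_gt0).
Qed.

Lemma hit_time_opS (c : A) (k : nat) :
  hit_time c = k.+1 -> k.+1 < n -> hit_time (op c) = k.
Proof.
move=> ck lt_kn; apply: hit_timeE; first exact: ltnW (ltnW lt_kn).
  by move=> _; rewrite -iterSr -ck iter_hit_time // ck.
by move=> i lt_ik; rewrite -iterSr; apply: hit_time_min; rewrite ck.
Qed.

(** This is where emptiness of [B_ n a] enters: otherwise a point at time
    infinity could move to one at time [n.-1]. *)
Lemma hit_time_op_never (c : A) : hit_time c = n -> hit_time (op c) = n.
Proof.
move=> cn; have nhit k : k < n -> iter k (@op A) c <> a.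
  by move=> lt_kn; apply: hit_time_min; rewrite cn.
apply: hit_timeE => // [|i lt_in]; first by rewrite ltnn.
rewrite -iterSr; move: lt_in; rewrite leq_eqVlt => /predU1P[->|]; last exact: nhit.
by move=> hn; have : B_ n a c by [apply/B_P]; rewrite Bn0.
Qed.

Definition hit_ord (c : A) : 'I_n.+1 := inord (hit_time c).

Lemma val_hit_ord (c : A) : hit_ord c = hit_time c :> nat.
Proof. by rewrite inordK // ltnS hit_time_le. Qed.

(** The operation that [op] induces on hitting times. *)
Definition countdown : monounary :=
  @Monounary 'I_n.+1 (fun i =>
    if i == 0 :> nat then hit_ord (op a)
    else if i == n :> nat then i else inord i.-1).

Lemma hit_time_homo : homomorphism (hit_ord : A -> countdown).
Proof.
move=> c /=; rewrite val_hit_ord; case: eqP => [/hit_time_eq0 -> //|c0].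
case: eqP => [cn|/eqP c_neq_n]; first by rewrite /hit_ord hit_time_op_never // cn.
have lt_cn : hit_time c < n by rewrite ltn_neqAle c_neq_n hit_time_le.
congr inord; case ck: (hit_time c) c0 lt_cn => [//|k] _ lt_kn.
exact: hit_time_opS.
Qed.

Lemma hit_ord_separates :
  ~ ((hit_ord : A -> countdown) @` [set~ a]) (hit_ord a).
Proof.
case=> c /= ca /(congr1 (@nat_of_ord _)); rewrite !val_hit_ord.
by rewrite (hit_time_eq0 a).2 // => /hit_time_eq0.
Qed.

End HitTime.

Theorem theorem6p14 (A : monounary) :
  completely_separable A <-> forall a : A, exists n : nat, B_ n a = set0.
Proof.
split=> [sepA a|B0 a].
  have [F [phi [[N cardF] hphi sep]]] := sepA a; exists N.
  rewrite -subset0 => b /(B_homo hphi sep).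
  by rewrite (B_card_eq0 _ cardF).
have [n Bn0] := B0 a; exists (countdown a n), (hit_ord a n); split.
- exact: finite_finset.
- exact: hit_time_homo.
- exact: hit_ord_separates.
Qed.
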